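(* Let $C, A_1,\dots,A_m\in\mathbb{S}^{n\times n}$ and $b\in\mathbb{R}^m$, with $\mathcal{A}$, $\mathcal{A}^T$ the associated linear map and its adjoint. Let $X^0\in\mathbb{S}^{n\times n}$, $y^0\in\mathbb{R}^m$, and let $(X^k,y^k)_{k\ge 0}$ be generated, for $k=0,1,2,\dots$, by $$X^{k+1} = \mathrm{Proj}_{\mathbb{S}_+^{n\times n}}\Big(X^k-\alpha_k\big(\mathcal{A}^T(y^k)+C\big)\Big),$$ $$y^{k+1} = y^k+\beta_k\,\mathcal{A}\big(X^{k+1}+\theta_k(X^{k+1}-X^k)\big)-\beta_k b,$$ where the real parameters $(\alpha_k,\theta_k,\beta_k)$ may be adjusted at each iteration (possibly depending on the previous iterates) and satisfy $$\alpha_k\in(\alpha_{\min},\alpha_{\max}),\qquad \sum_{k=1}^{\infty}|\alpha_{k+1}-\alpha_k|<\infty,\qquad \theta_k=\frac{\alpha_k}{\alpha_{k-1}}\ (k\ge 1),\qquad \alpha_k\beta_k=R,$$ with $\theta_0\in\mathbb{R}$ an arbitrary initial value, $0<\alpha_{\min}\le\alpha_{\max}<\infty$ and $0<R<\frac{1}{\lambda_{\max}(\mathcal{A}^T\mathcal{A})}$. Then $(X^k,y^k)$ converges weakly to some $(X^*,y^* )$ such that $$0\in C+\partial_X\mathbb{I}_{\mathbb{S}_+^{n\times n}}(X^* )+\partial_X\mathbb{I}_{=b}(\mathcal{A}(X^* )).$$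
   Context: $\mathbb{S}^{n\times n}$ is the space of real symmetric $n\times n$ matrices with inner product $\langle A,B\rangle=\sum_{i,j}A_{ij}B_{ij}$, and $\mathbb{S}_+^{n\times n}$ is the cone of positive semidefinite matrices. The linear map $\mathcal{A}:\mathbb{S}^{n\times n}\to\mathbb{R}^m$ is $\mathcal{A}(X)=(\langle A_1,X\rangle,\dots,\langle A_m,X\rangle)^T$, with adjoint $\mathcal{A}^T(y)=\sum_{i=1}^m y_iA_i$. $\lambda_{\max}(\mathcal{A}^T\mathcal{A})$ is the largest eigenvalue of the self-adjoint operator $\mathcal{A}^T\mathcal{A}$. $\mathrm{Proj}_S$ is the orthogonal projection onto the closed convex set $S$. The underlying semidefinite program is: minimize $\langle C,X\rangle$ subject to $\mathcal{A}(X)=b$, $X\in\mathbb{S}_+^{n\times n}$. $\mathbb{I}_{\mathbb{S}_+^{n\times n}}(X)$ is $0$ if $X\in\mathbb{S}_+^{n\times n}$ and $+\infty$ otherwise; $\mathbb{I}_{=b}(y)$ is $0$ if $y=b$ and $+\infty$ otherwise. $\partial$ denotes the convex subdifferential, and $\partial_X\mathbb{I}_{=b}(\mathcal{A}(X^* ))$ is the subdifferential at $X^*$ of the function $X\mapsto\mathbb{I}_{=b}(\mathcal{A}(X))$.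
   Formalization: Adds the hypothesis that some X satisfies 0 ∈ C + ∂I_{S_+}(X) + ∂I_{=b}(A(X)); without it the claim fails (n=m=1, A_1=1, b=-1, C=0 is infeasible), and the conclusion itself implies it. *)

(* Defs.v *)
From HB Require Import structures.
From mathcomp Require Import all_boot all_order all_algebra.
From mathcomp Require Import all_classical all_reals all_analysis.

Set Implicit Arguments.
Unset Strict Implicit.
Unset Printing Implicit Defensive.

Import Order.TTheory GRing.Theory Num.Theory.
Import numFieldNormedType.Exports.

Local Open Scope classical_set_scope.
Local Open Scope ring_scope.

Section Definitions.
Context {R : realType}.
Implicit Types n m : nat.

(* The space of symmetric matrices is represented as a subset of 'M[R]_n;
   every quantification below that ranges over this space carries an explicit
   membership condition. *)
Definition symm n : set 'M[R]_n := [set X | X \is symmetricmx].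

Definition psd n : set 'M[R]_n :=
  [set X | symm X /\ forall v : 'cV[R]_n, 0 <= (v^T *m X *m v) 0 0].

Definition mxdot n m (X Y : 'M[R]_(n, m)) : R :=
  \sum_(i < n) \sum_(j < m) X i j * Y i j.

Definition frobenius n (X : 'M[R]_n) : R := Num.sqrt (mxdot X X).

Definition opA n m (A : 'I_m -> 'M[R]_n) (X : 'M[R]_n) : 'cV[R]_m :=
  \col_i mxdot (A i) X.

Definition adjA n m (A : 'I_m -> 'M[R]_n) (y : 'cV[R]_m) : 'M[R]_n :=
  \sum_(i < m) y i 0 *: A i.

Definition is_eigenvalue n (T : 'M[R]_n -> 'M[R]_n) (l : R) : Prop :=
  exists X : 'M[R]_n, [/\ symm X, X != 0 & T X = l *: X].

(* For a self-adjoint operator on a nonzero space the set of eigenvalues is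
   finite and nonempty, so this supremum is its maximum; for n = 0 there is no
   eigenvalue and the value is sup set0 = 0. *)
Definition lambda_max n (T : 'M[R]_n -> 'M[R]_n) : R :=
  sup [set l | is_eigenvalue T l].

(* P is the orthogonal projection of Z onto S, i.e. its nearest point in S;
   it is unique when S is convex. *)
Definition is_proj n (S : set 'M[R]_n) (Z P : 'M[R]_n) : Prop :=
  S P /\ forall Q, S Q -> frobenius (Z - P) <= frobenius (Z - Q).

Definition indicator_fun (T : Type) (S : set T) (x : T) : \bar R :=
  if `[< S x >] then 0%E else +oo%E.

(* Subdifferential in the space of symmetric matrices. It is empty outside the
   effective domain, also for a function that is identically +oo (as
   X |-> I_{=b}(A(X)) is when A(X) = b has no solution). *)
Definition subdiff n (f : 'M[R]_n -> \bar R) (X : 'M[R]_n) : set 'M[R]_n :=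
  [set G | [/\ symm X, f X \is a fin_num, symm G &
     forall Y, symm Y -> (f X + (mxdot G (Y - X))%:E <= f Y)%E]].

(* 0 \in C + \partial I_{psd}(X) + \partial (I_{=b} \o A)(X), the sum of sets
   being the Minkowski sum. *)
Definition optimality n m (C : 'M[R]_n) (A : 'I_m -> 'M[R]_n) (b : 'cV[R]_m)
    (X : 'M[R]_n) : Prop :=
  [set C + G + H | G in subdiff (indicator_fun (@psd n)) X
                 & H in subdiff (fun Y => indicator_fun [set b] (opA A Y)) X] 0.

(* Weak convergence in the product of the symmetric matrices and R^m: the
   continuous linear functionals are the inner products with fixed (Z, w). *)
Definition weak_cvg n m (X : nat -> 'M[R]_n) (y : nat -> 'cV[R]_m)
    (Xs : 'M[R]_n) (ys : 'cV[R]_m) : Prop :=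
  forall (Z : 'M[R]_n) (w : 'cV[R]_m), symm Z ->
    (fun k => mxdot Z (X k) + mxdot w (y k)) @ \oo --> mxdot Z Xs + mxdot w ys.

End Definitions.

(* Main.v *)
(* For constant alpha this is a proximal point method in the metric
   E_a(x, v) = |x|^2 + (a^2 / rho) |v|^2 - 2 a <v, A x>,
   which is positive definite because rho * lambda_max (A^T A) < 1.  If
   (Xh, yh) is a KKT pair, one step with theta = 1 would decrease
   E_alpha (X - Xh, y - yh) by at least E_alpha of the increment; the variation
   of alpha and the deviation of theta from 1 only multiply this by 1 + eps_k
   with (eps_k) summable.  Hence the iterates are quasi-Fejer monotone and the
   increments tend to 0.  Cluster points are then KKT pairs, and
   quasi-Fejer monotonicity with respect to one of them gives convergence. *)

Require Import Defs.
From HB Require Import structures.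
From mathcomp Require Import all_boot all_order all_algebra.
From mathcomp Require Import all_classical all_reals all_analysis.
From mathcomp Require Import ring lra.

Set Implicit Arguments.
Unset Strict Implicit.
Unset Printing Implicit Defensive.

Import Order.TTheory GRing.Theory Num.Theory.
Import numFieldNormedType.Exports.

Local Open Scope classical_set_scope.
Local Open Scope ring_scope.

(** * The trace inner product *)

Section InnerProduct.
Context {R : realType} {p q : nat}.
Implicit Types (U V W : 'M[R]_(p, q)) (a t : R).

Lemma mxdotC U V : mxdot U V = mxdot V U.
Proof. by apply: eq_bigr => i _; apply: eq_bigr => j _; rewrite mulrC. Qed.

Lemma mxdotDl U V W : mxdot (U + V) W = mxdot U W + mxdot V W.
Proof.
rewrite /mxdot -big_split; apply: eq_bigr => i _.
by rewrite -big_split; apply: eq_bigr => j _; rewrite mxE mulrDl.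
Qed.

Lemma mxdotZl a U V : mxdot (a *: U) V = a * mxdot U V.
Proof.
rewrite /mxdot mulr_sumr; apply: eq_bigr => i _.
by rewrite mulr_sumr; apply: eq_bigr => j _; rewrite mxE mulrA.
Qed.

Lemma mxdotNl U V : mxdot (- U) V = - mxdot U V.
Proof. by rewrite -scaleN1r mxdotZl mulN1r. Qed.

Lemma mxdotBl U V W : mxdot (U - V) W = mxdot U W - mxdot V W.
Proof. by rewrite mxdotDl mxdotNl. Qed.

Lemma mxdotDr U V W : mxdot U (V + W) = mxdot U V + mxdot U W.
Proof. by rewrite mxdotC mxdotDl !(mxdotC U). Qed.

Lemma mxdotZr a U V : mxdot U (a *: V) = a * mxdot U V.
Proof. by rewrite mxdotC mxdotZl mxdotC. Qed.

Lemma mxdotNr U V : mxdot U (- V) = - mxdot U V.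
Proof. by rewrite mxdotC mxdotNl mxdotC. Qed.

Lemma mxdotBr U V W : mxdot U (V - W) = mxdot U V - mxdot U W.
Proof. by rewrite mxdotDr mxdotNr. Qed.

Lemma mxdot0l U : mxdot 0 U = 0.
Proof. by rewrite -(scale0r 0) mxdotZl mul0r. Qed.

Definition mxdotE := (mxdotBl, mxdotBr, mxdotDl, mxdotDr, mxdotNl, mxdotNr,
  mxdotZl, mxdotZr).

Lemma mxdot_ge0 U : 0 <= mxdot U U.
Proof.
by apply: sumr_ge0 => i _; apply: sumr_ge0 => j _; rewrite -expr2 sqr_ge0.
Qed.

Lemma sqr_entry_le U i j : U i j ^+ 2 <= mxdot U U.
Proof.
rewrite /mxdot (bigD1 i) //= (bigD1 j) //= -expr2 -addrA lerDl addr_ge0 //.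
  by apply: sumr_ge0 => ? _; rewrite -expr2 sqr_ge0.
by apply: sumr_ge0 => ? _; apply: sumr_ge0 => ? _; rewrite -expr2 sqr_ge0.
Qed.

Lemma mxdot_eq0 U : mxdot U U = 0 -> U = 0.
Proof.
move=> U0; apply/matrixP => i j; rewrite mxE; apply/eqP.
by rewrite -sqrf_eq0 eq_le sqr_ge0 andbT -U0 sqr_entry_le.
Qed.

(** Expand [0 <= |t U - V|^2] and divide by [t]. *)
Lemma mxdot_young t U V : 0 < t ->
  2 * mxdot U V <= t * mxdot U U + t^-1 * mxdot V V.
Proof.
move=> t0; have := mxdot_ge0 (t *: U - V).
rewrite !mxdotE (mxdotC V U) => H.
rewrite -subr_ge0 -(pmulr_rge0 _ t0).
apply: le_trans H _; rewrite le_eqVlt; apply/orP; left; apply/eqP.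
by field; rewrite gt_eqF.
Qed.

Lemma mxdot_youngN t U V : 0 < t ->
  - (2 * mxdot U V) <= t * mxdot U U + t^-1 * mxdot V V.
Proof.
by move=> t0; have := mxdot_young (- U) V t0; rewrite !mxdotE opprK mulrN.
Qed.

Lemma mxdot_sqrD U V : mxdot (U + V) (U + V) <= 2 * mxdot U U + 2 * mxdot V V.
Proof.
by have := mxdot_ge0 (U - V); rewrite !mxdotE (mxdotC V U); lra.
Qed.

Lemma mxdot_sqrB U V : mxdot (U - V) (U - V) <= 2 * mxdot U U + 2 * mxdot V V.
Proof. by have := mxdot_sqrD U (- V); rewrite !(mxdotNl V) mxdotNr opprK. Qed.

Lemma cauchy_schwarz U V : mxdot U V ^+ 2 <= mxdot U U * mxdot V V.
Proof.
have [U0|U0] := eqVneq (mxdot U U) 0.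
  by rewrite (mxdot_eq0 U0) !mxdot0l expr0n mul0r.
have Ugt0 : 0 < mxdot U U by rewrite lt_neqAle eq_sym U0 mxdot_ge0.
(* The squared norm of this combination factors as [|U|^2 (|U|^2 |V|^2 - <U, V>^2)]. *)
have := mxdot_ge0 (mxdot U V *: U - mxdot U U *: V).
rewrite !mxdotE (mxdotC V U) => H.
rewrite -subr_ge0 -(pmulr_rge0 _ Ugt0).
by apply: le_trans H _; rewrite le_eqVlt; apply/orP; left; apply/eqP; ring.
Qed.

Lemma cvg_mxdot (U V : nat -> 'M[R]_(p, q)) U' V' :
  (forall i j, U k i j @[k --> \oo] --> U' i j) ->
  (forall i j, V k i j @[k --> \oo] --> V' i j) ->
  mxdot (U k) (V k) @[k --> \oo] --> mxdot U' V'.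
Proof.
move=> UU' VV'; rewrite /mxdot.
apply: (cvg_big (op := +%R)); first exact: add_continuous.
move=> i _; apply: (cvg_big (op := +%R)); first exact: add_continuous.
by move=> j _; apply: cvgM.
Qed.

Lemma cvg_mxdot0 (U : nat -> 'M[R]_(p, q)) U' :
  mxdot (U k - U') (U k - U') @[k --> \oo] --> 0 ->
  forall i j, U k i j @[k --> \oo] --> U' i j.
Proof.
move=> H i j; apply/cvgrPdist_lt => e e0.
have e20 : 0 < e ^+ 2 by rewrite exprn_gt0.
move/cvgrPdist_lt: H => /(_ _ e20); apply: filterS => k.
rewrite sub0r normrN ger0_norm ?mxdot_ge0 // => Hk.
rewrite distrC -(ltr_pXn2r (n := 2)) ?nnegrE ?(ltW e0) //.
rewrite real_normK ?num_real //; apply: le_lt_trans Hk.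
by have := sqr_entry_le (U k - U') i j; rewrite !mxE.
Qed.

End InnerProduct.

Lemma frobenius_le (R : realType) (n : nat) (U V : 'M[R]_n) :
  (frobenius U <= frobenius V) = (mxdot U U <= mxdot V V).
Proof. by rewrite /frobenius ler_sqrt // mxdot_ge0. Qed.

(** * Extraction of convergent subsequences *)

Lemma cvg_subseq (R : realType) (u : nat -> R) (l : R) (f : nat -> nat) :
  (forall k, (k <= f k)%N) -> u k @[k --> \oo] --> l ->
  u (f k) @[k --> \oo] --> l.
Proof.
move=> fk ul; apply: (cvg_comp f u) ul => P [N _ NP].
by exists N => // k /= Nk; apply: NP => /=; apply: leq_trans (fk k).
Qed.

(** Bolzano-Weierstrass one coordinate at a time: each new coordinate refines the extraction made
    for the previous ones. The condition [k <= f k] is stable under composition and already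
    preserves limits. *)
Lemma bounded_subseq (R : realType) (I : eqType) (s : seq I)
    (u : nat -> I -> R) (M : R) :
  (forall k i, `|u k i| <= M) ->
  exists f : nat -> nat, (forall k, (k <= f k)%N) /\
    forall i, i \in s -> cvgn (fun k => u (f k) i).
Proof.
move=> uM; elim: s => [|i s [f [fk cvs]]]; first by exists id.
have [] := @bolzano_weierstrass R (fun k => u (f k) i).
  exists M; split; rewrite ?num_real // => x Mx k _ /=.
  exact: le_trans (uM _ _) (ltW Mx).
move=> g gi cvi.
have gk k : (k <= g k)%N.
  elim: k => // k IH; apply: leq_ltn_trans IH _.
  by rewrite ltnNge; have := gi k.+1 k; rewrite /Order.le /= ltnn => ->.
exists (f \o g); split => [k|j]; first exact: leq_trans (gk k) (fk _).
rewrite inE => /predU1P[-> //|/cvs cj].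
by apply/cvg_ex; exists (limn (fun k => u (f k) j)); apply: (cvg_subseq gk cj).
Qed.

Lemma bounded_mx_subseq (R : realType) (p q : nat) (U : nat -> 'M[R]_(p, q))
    (M : R) :
  (forall k, mxdot (U k) (U k) <= M) ->
  exists (f : nat -> nat) (L : 'M[R]_(p, q)), (forall k, (k <= f k)%N) /\
    forall i j, U (f k) i j @[k --> \oo] --> L i j.
Proof.
move=> UM.
have UM' k (ij : 'I_p * 'I_q) : `|U k ij.1 ij.2| <= M + 1.
  have := le_trans (sqr_entry_le (U k) ij.1 ij.2) (UM k).
  rewrite -real_normK ?num_real //; nra.
have [f [fk cf]] := bounded_subseq (enum [set: 'I_p * 'I_q]) UM'.
exists f, (\matrix_(i, j) limn (fun k => U (f k) i j)); split => // i j.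
by rewrite mxE; apply: (cf (i, j)); rewrite mem_enum inE.
Qed.

(** * Symmetric matrices and the operator *)

Section SymmetricMatrices.
Context {R : realType} {n : nat}.
Implicit Types (U V : 'M[R]_n) (a : R).

Lemma symmP U : symm U <-> U^T = U.
Proof.
rewrite /symm /=; split => [/is_hermitianmxP|UT].
  by rewrite expr0 scale1r map_mx_id.
by apply/is_hermitianmxP; rewrite expr0 scale1r map_mx_id // UT.
Qed.

Lemma symmD U V : symm U -> symm V -> symm (U + V).
Proof. by rewrite !symmP linearD /= => -> ->. Qed.

Lemma symmZ a U : symm U -> symm (a *: U).
Proof. by rewrite !symmP linearZ /= => ->. Qed.

Lemma symmN U : symm U -> symm (- U).
Proof. by rewrite !symmP linearN /= => ->. Qed.

Lemma symmB U V : symm U -> symm V -> symm (U - V).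
Proof. by move=> sU sV; apply: symmD => //; apply: symmN. Qed.

Lemma symm0 : symm (0 : 'M[R]_n).
Proof. by rewrite symmP trmx0. Qed.

Lemma symm_lim (U : nat -> 'M[R]_n) U' : (forall k, symm (U k)) ->
  (forall i j, U k i j @[k --> \oo] --> U' i j) -> symm U'.
Proof.
move=> sU UU'; apply/symmP/matrixP => i j; rewrite mxE.
have E : (fun k => U k j i) = (fun k => U k i j).
  by apply/funext => k; move/symmP: (sU k) => /matrixP /(_ i j); rewrite mxE.
by have := UU' j i; rewrite E => Uji; apply: cvg_unique Uji (UU' i j).
Qed.

Lemma mxdot_trmx U V : mxdot U^T V^T = mxdot U V.
Proof.
rewrite /mxdot exchange_big; apply: eq_bigr => i _; apply: eq_bigr => j _.
by rewrite !mxE.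
Qed.

(** Vectorisation turns the trace inner product into a matrix product, so that row space and kernel
    arguments apply to matrices. *)
Lemma mxdot_mxvec U V : mxdot U V = (mxvec U *m (mxvec V)^T) 0 0.
Proof.
rewrite mxE /mxdot pair_bigA /=.
rewrite (reindex _ (curry_mxvec_bij n n)) /=.
by apply: eq_bigr => -[i j] _; rewrite mxE /= !mxvecE.

Qed.

Lemma psd_convex U V t : psd U -> psd V -> 0 <= t <= 1 ->
  psd (U + t *: (V - U)).
Proof.
move=> [sU pU] [sV pV] /andP[t0 t1]; split.
  by apply: symmD => //; apply: symmZ; apply: symmB.
move=> v; have -> : U + t *: (V - U) = (1 - t) *: U + t *: V.
  by rewrite scalerBr scalerBl scale1r addrA addrAC.
rewrite mulmxDr mulmxDl -!scalemxAr -!scalemxAl [leRHS]mxE.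
rewrite [X in 0 <= X + _]mxE [X in 0 <= _ + X]mxE.
by rewrite addr_ge0 ?mulr_ge0 ?subr_ge0.
Qed.

(** The variational inequality of the projection: were the inner product positive, a short move from
    [P] towards [Q] would come closer to [Z]. *)
Lemma is_proj_psd_le Z P Q : is_proj (@psd R n) Z P -> psd Q ->
  mxdot (Z - P) (Q - P) <= 0.
Proof.
move=> [pP minP] pQ; rewrite leNgt; apply/negP => c0.
set c := mxdot _ _ in c0; set d := mxdot (Q - P) (Q - P).
have d0 : 0 <= d := mxdot_ge0 _.
have dc : 0 < d + c by lra.
(* Minimality of [P] requires [2 c <= t d], whereas this [t] lies in (0, 1] and gives [t d < c]. *)
pose t := c / (d + c).
have t0 : 0 < t by rewrite divr_gt0.
have t1 : t <= 1 by rewrite ler_pdivrMr // mul1r lerDr.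
have tE : t * (d + c) = c by rewrite divfK // gt_eqF.
have := minP _ (psd_convex pP pQ (introT andP (conj (ltW t0) t1))).
rewrite frobenius_le opprD addrA.
set W := Z - P; rewrite !(mxdotBl W) !(mxdotBr _ W) !mxdotZl !mxdotZr.
rewrite (mxdotC _ W) -/c -/d; nra.
Qed.

End SymmetricMatrices.

(** * The operator, its adjoint, and the norm bound by the largest eigenvalue *)

Section Operator.
Context {R : realType} {n m : nat} (A : 'I_m -> 'M[R]_n).
Implicit Types (U V : 'M[R]_n) (v w : 'cV[R]_m) (a : R).

Lemma opAB U V : opA A (U - V) = opA A U - opA A V.
Proof. by apply/matrixP => i j; rewrite !mxE mxdotBr. Qed.

Lemma opAD U V : opA A (U + V) = opA A U + opA A V.
Proof. by apply/matrixP => i j; rewrite !mxE mxdotDr. Qed.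

Lemma opAZ a U : opA A (a *: U) = a *: opA A U.
Proof. by apply/matrixP => i j; rewrite !mxE mxdotZr. Qed.

Lemma adjAB v w : adjA A (v - w) = adjA A v - adjA A w.
Proof.
rewrite /adjA -sumrB; apply: eq_bigr => i _.
by rewrite !mxE scalerBl.
Qed.

Lemma mxdot_adjA v U : mxdot (adjA A v) U = mxdot v (opA A U).
Proof.
rewrite /adjA.
have -> : mxdot v (opA A U) = \sum_(i < m) v i 0 * mxdot (A i) U.
  by apply: eq_bigr => i _; rewrite big_ord1 mxE.
elim/big_ind2: _ => [|x1 x2 y1 y2 <- <-|i _]; rewrite ?mxdot0l ?mxdotDl //.
by rewrite mxdotZl.
Qed.

Hypothesis A_symm : forall i, symm (A i).

Lemma symm_adjA v : symm (adjA A v).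
Proof.
rewrite /adjA; elim/big_ind: _ => [|U V|i _].
- exact: symm0.
- exact: symmD.
- exact/symmZ/A_symm.
Qed.

(* The duality between row space and kernel yields test directions [D] that
   need not be symmetric; they are replaced by [D + D^T]. *)
Lemma orthogonal_kernel_adjA H : symm H ->
  (forall D, symm D -> opA A D = 0 -> mxdot H D = 0) ->
  exists v, H = adjA A v.
Proof.
move=> sH kerH; pose M : 'M[R]_(m, n * n) := \matrix_i mxvec (A i).
(* The rows of [M] are the vectorised [A i], so [H] has the required form once it lies in the row
   space of [M], that is, once the columns of [cokermx M] annihilate it. *)
have /submxP[w Hw] : (mxvec H <= M)%MS.
  rewrite submxE; apply/eqP/matrixP => i j; rewrite (ord1 i) [RHS]mxE.
  pose D : 'M[R]_n := vec_mx (col j (cokermx M))^T.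
  have dotD U : mxdot U D = (mxvec U *m cokermx M) 0 j.
    rewrite mxdot_mxvec vec_mxK trmxK mxE [RHS]mxE.
    by apply: eq_bigr => k _; rewrite [col _ _ _ _]mxE.
  have dotDT U : symm U -> mxdot U D^T = mxdot U D.
    by move=> /symmP sU; rewrite -mxdot_trmx trmxK sU.
  have AD i0 : mxdot (A i0) D = 0.
    rewrite dotD.
    have := mulmx_coker M => /(congr1 (row i0)).
    by rewrite row_mul rowK row0 => ->; rewrite mxE.
  rewrite -dotD; have : mxdot H (D + D^T) = 0.
    apply: kerH; first by apply/symmP; rewrite linearD /= trmxK addrC.
    by apply/matrixP => k l; rewrite !mxE mxdotDr dotDT // AD addr0.
  rewrite mxdotDr dotDT //; lra.
exists w^T; apply: (can_inj mxvecK); rewrite Hw mulmx_sum_row /adjA linear_sum.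
by apply: eq_bigr => i _; rewrite rowK linearZ /= mxE.
Qed.

(** Cauchy-Schwarz in each component. This crude bound serves to make the suprema of eigenvalues and
    of Rayleigh quotients finite. *)
Lemma opA_bounded : exists2 K : R, 0 <= K &
  forall U, mxdot (opA A U) (opA A U) <= K * mxdot U U.
Proof.
exists (\sum_(i < m) mxdot (A i) (A i)).
  by apply: sumr_ge0 => i _; apply: mxdot_ge0.
move=> U; rewrite {1}/mxdot mulr_suml; apply: ler_sum => i _.
by rewrite big_ord1 !mxE -expr2 cauchy_schwarz.
Qed.

(** A maximiser of the Rayleigh quotient is an eigenvector, so [L] is itself an eigenvalue and lies
    below their supremum. *)
Lemma lambda_max_attained L X : symm X -> X != 0 ->
  (forall U, symm U -> mxdot (opA A U) (opA A U) <= L * mxdot U U) ->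
  mxdot (opA A X) (opA A X) = L * mxdot X X ->
  L <= lambda_max (fun Z => adjA A (opA A Z)).
Proof.
move=> sX X0 LU LX.
apply: ub_le_sup; last first.
  exists X; split => //; apply/esym/eqP; rewrite -subr_eq0; apply/eqP.
  set G := _ - _; apply: mxdot_eq0.
  have sG : symm G by apply: symmB; [exact: symmZ|exact: symm_adjA].
  (* [L |U|^2 - |A U|^2] is minimal at [X], so its derivative vanishes there. *)
  have GG : mxdot G G = L * mxdot X G - mxdot (opA A X) (opA A G).
    by rewrite {1}/G mxdotBl mxdotZl mxdot_adjA.
  clearbody G.
  set g := mxdot G G.
  set e := L * mxdot G G - mxdot (opA A G) (opA A G).
  have e0 : 0 <= e by rewrite subr_ge0 LU.
  have g0 : 0 <= g := mxdot_ge0 G.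
  have H t : 0 <= e * t ^+ 2 - 2 * t * g.
    have := LU (X - t *: G) (symmB sX (symmZ t sG)).
    rewrite opAB opAZ !mxdotE LX (mxdotC G X) (mxdotC (opA A G) (opA A X)).
    by rewrite /g /e GG -subr_ge0 => K; apply: le_trans K _;
       rewrite le_eqVlt; apply/orP; left; apply/eqP; ring.
  (* With [g = t (e + 1)] the inequality [H] reads [0 <= - t^2 (e + 2)], which forces [t = 0] and
     hence [g = 0]; adding 1 keeps the denominator positive. *)
  have := H (g / (e + 1)); set t := g / _.
  have tE : t * (e + 1) = g by rewrite divfK // gt_eqF //; lra.
  have t0 : 0 <= t by rewrite divr_ge0 //; lra.
  by nra.
have [K K0 bK] := opA_bounded.
exists K => l [Z [sZ Z0 TZ]].
have Zgt0 : 0 < mxdot Z Z.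
  rewrite lt_neqAle mxdot_ge0 andbT eq_sym; apply: contra Z0 => /eqP Z0.
  by apply/eqP; apply: mxdot_eq0.
rewrite -(ler_pM2r Zgt0); apply: le_trans (bK Z).
by rewrite -mxdot_adjA TZ mxdotZl.
Qed.

(** The supremum of the Rayleigh quotient over nonzero symmetric matrices is attained, by
    compactness of the unit sphere, and an attained supremum is an eigenvalue. *)
Lemma opA_lambda_max U : symm U ->
  mxdot (opA A U) (opA A U) <=
    lambda_max (fun Z => adjA A (opA A Z)) * mxdot U U.
Proof.
move=> sU; have [->|U0] := eqVneq U 0.
  have A0 : opA A 0 = 0 by rewrite -[X in opA A X](scale0r 0) opAZ scale0r.
  by rewrite A0 !mxdot0l mulr0.
have pos V : V != 0 -> 0 < mxdot V V.
  move=> V0; rewrite lt_neqAle mxdot_ge0 andbT eq_sym; apply: contra V0.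
  by move=> /eqP V0; apply/eqP; apply: mxdot_eq0.
pose q V := mxdot (opA A V) (opA A V).
pose E : set R := [set r | exists V, [/\ symm V, V != 0 & r = q V / mxdot V V]].
have [K K0 bK] := opA_bounded.
have ubE : has_ubound E.
  exists K => r [V [sV V0 ->]]; rewrite ler_pdivrMr ?pos //; exact: bK.
have supE : has_sup E by split => //; exists (q U / mxdot U U), U.
have leE V : symm V -> q V <= sup E * mxdot V V.
  move=> sV; have [->|V0] := eqVneq V 0.
    have A0 : opA A 0 = 0 by rewrite -[X in opA A X](scale0r 0) opAZ scale0r.
    by rewrite /q A0 !mxdot0l mulr0.
  rewrite -ler_pdivrMr ?pos //; apply: ub_le_sup => //; by exists V.
apply: le_trans (leE _ sU) _; apply: ler_wpM2r; first exact: mxdot_ge0.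
(* A maximising sequence, normalised so that it has a cluster point of norm 1. *)
have choose k : exists V, [/\ symm V, mxdot V V = 1 & sup E - k.+1%:R^-1 < q V].
  have k0 : 0 < k.+1%:R^-1 :> R by rewrite invr_gt0.
  have [r [V [sV V0 ->]] rlt] := sup_adherent k0 supE.
  set s := Num.sqrt (mxdot V V).
  have s2 : s ^+ 2 = mxdot V V by rewrite sqr_sqrtr // ltW // pos.
  have s0 : s != 0 by rewrite -sqrf_eq0 s2 gt_eqF // pos.
  exists (s^-1 *: V); split; first exact: symmZ.
    by rewrite mxdotZl mxdotZr -s2; field.
  suff -> : q (s^-1 *: V) = q V / mxdot V V by [].
  by rewrite /q opAZ mxdotZl mxdotZr -s2; field.
have [W W_] := boolp.choice choose.
have W1 k : mxdot (W k) (W k) <= 1 by have [_ -> _] := W_ k.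
have [f [X [fk WX]]] := bounded_mx_subseq W1.
have sX : symm X by apply: symm_lim WX => k; have [] := W_ (f k).
have X1 : mxdot X X = 1.
  have E1 : (fun k => mxdot (W (f k)) (W (f k))) = cst 1.
    by apply/funext => k; have [_ -> _] := W_ (f k).
  have := cvg_mxdot WX WX; rewrite E1 => W1X.
  have c1 : cst (1 : R) @ \oo --> (1 : R) by exact: cvg_cst.
  by apply: cvg_unique W1X c1.
have qX : q X = sup E * mxdot X X.
  apply/eqP; rewrite eq_le leE //= X1 mulr1.
  have AW i j : opA A (W (f k)) i j @[k --> \oo] --> opA A X i j.
    under eq_cvg do rewrite mxE.
    by rewrite mxE; apply: cvg_mxdot => // i' j'; apply: cvg_cst.
  have cq := cvg_mxdot AW AW.
  have cs : sup E - (harmonic k : R) @[k --> \oo] --> sup E.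
    rewrite -[X in _ --> X]subr0; apply: cvgB; first exact: cvg_cst.
    exact: cvg_harmonic.
  apply: ler_cvg_to cs cq _; apply: nearW => k.
  have [_ _ /ltW] := W_ (f k); apply: le_trans.
  rewrite lerD2l lerN2 /= lef_pV2 ?posrE // ler_nat ltnS; exact: fk.
apply: (lambda_max_attained sX) => //.
apply/eqP => X0; move: X1; rewrite X0 mxdot0l => /eqP.
by rewrite eq_sym oner_eq0.
Qed.

(** A positive value is cleared from the denominator; otherwise the product is at most 0. The value
    0, with inverse [+oo], does occur, for instance when [A = 0]. *)
Lemma rho_lambda_max_lt1 rho : 0 < rho ->
  (rho%:E < (lambda_max (fun Z => adjA A (opA A Z)))%:E^-1)%E ->
  rho * lambda_max (fun Z => adjA A (opA A Z)) < 1.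
Proof.
set l := lambda_max _ => rho0; rewrite inver.
have [->|l0] := eqVneq l 0; first by rewrite mulr0.
rewrite lte_fin; have [lgt|lle] := ltP 0 l.
  by rewrite -div1r ltr_pdivlMr.
by move=> _; nra.
Qed.

End Operator.

(** * Quasi-Fejer sequences and KKT pairs *)

(** Since [1 + e k <= expR (e k)], discounting [E] by the exponential of the partial sums of [e]
    gives a nonincreasing sequence [F], whose decrements dominate [D] up to the factor [expR M]. *)
Lemma quasi_fejer (R : realType) (E D e : nat -> R) (M : R) :
  (forall k, 0 <= E k) -> (forall k, 0 <= D k) -> (forall k, 0 <= e k) ->
  (forall k, \sum_(0 <= i < k) e i <= M) ->
  (forall k, E k.+1 + D k <= (1 + e k) * E k) ->
  (forall n k, (n <= k)%N -> E k <= expR M * E n) /\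
  D k @[k --> \oo] --> 0.
Proof.
move=> E0 D0 e0 eM step; pose S k := \sum_(0 <= i < k) e i.
have S0 k : 0 <= S k by apply: sumr_ge0.
pose F k := E k * expR (- S k).
have FD k : F k.+1 + D k * expR (- M) <= F k.
  have -> : F k = (E k * expR (e k)) * expR (- S k.+1).
    by rewrite -mulrA -expRD /F /S big_nat_recr //=; congr (_ * expR _); lra.
  apply: (@le_trans _ _ ((E k.+1 + D k) * expR (- S k.+1))).
    rewrite mulrDl lerD2l ler_wpM2l // ler_expR lerN2; exact: eM.
  rewrite ler_wpM2r ?expR_ge0 //; apply: le_trans (step k) _.
  by rewrite mulrC ler_wpM2l // expR_ge1Dx.
have F0 k : 0 <= F k by rewrite mulr_ge0 ?expR_ge0.
have Fni : nonincreasing_seq F.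
  apply/nonincreasing_seqP => k; apply: le_trans (FD k).
  by rewrite lerDl mulr_ge0 ?expR_ge0.
split=> [n k nk|].
  have -> : E k = F k * expR (S k) by rewrite -mulrA -expRD addNr expR0 mulr1.
  rewrite mulrC; apply: ler_pM; rewrite ?expR_ge0 ?ler_expR //; first exact: eM.
  apply: le_trans (Fni _ _ nk) _.
  by rewrite /F ler_piMr // -expR0 ler_expR oppr_le0.
have cF : cvgn F.
  by apply: nonincreasing_is_cvgn => //; exists 0 => _ [k _ <-].
have cF1 : F k.+1 @[k --> \oo] --> limn F by rewrite (cvg_shiftS F).
have cd : (F k - F k.+1) * expR M @[k --> \oo] --> 0.
  rewrite -(mul0r (expR M)) -(subrr (limn F)).
  by apply: cvgM; [exact: cvgB|exact: cvg_cst].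
apply: squeeze_cvgr cd; last exact: cvg_cst.
apply: nearW => k; rewrite D0 /=; have := FD k.
rewrite -lerBrDl -(ler_pM2r (expR_gt0 M)) -mulrA -expRD addNr expR0 mulr1.
by [].
Qed.

Section Saddle.
Context {R : realType} {n m : nat}.
Variables (C : 'M[R]_n) (A : 'I_m -> 'M[R]_n) (b : 'cV[R]_m).

(* [X] is primal feasible, and [- (adjA A y + C)] is normal to the cone at
   [X]: a KKT pair of the semidefinite program. *)
Definition saddle (X : 'M[R]_n) (y : 'cV[R]_m) : Prop :=
  [/\ psd X, opA A X = b &
      forall Y, psd Y -> 0 <= mxdot (adjA A y + C) (Y - X)].

Hypothesis A_symm : forall i, symm (A i).

(** The subdifferential of an indicator function is the normal cone. *)
Lemma subdiff_indicator (S : set 'M[R]_n) X G :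
  subdiff (indicator_fun S) X G <->
  [/\ symm X, S X, symm G & forall Y, symm Y -> S Y -> mxdot G (Y - X) <= 0].
Proof.
rewrite /subdiff /= /indicator_fun; split.
  case: asboolP => [SX [sX _ sG H]|_ []//]; split => // Y sY SY.
  by have := H Y sY; rewrite asboolT // add0e lee_fin.
move=> [sX SX sG H]; rewrite asboolT //; split => // Y sY.
by case: asboolP => SY; rewrite add0e ?leey // lee_fin H.
Qed.

(** A normal [H] to the affine set [opA A Y = b] is orthogonal to the kernel of [opA A], hence of
    the form [adjA A y]; this [y] is the multiplier. *)
Lemma optimality_saddle X : optimality C A b X -> exists y, saddle X y.
Proof.
case=> G /subdiff_indicator [sX pX sG GX] [H Hsub CGH].
move: Hsub; rewrite (_ : (fun Y => _) =
  indicator_fun [set Y | opA A Y = b]); last first.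
  by apply/funext => Y; rewrite /indicator_fun.
move=> /subdiff_indicator [_ AX sH HX].
have [D sD AD|y Hy] := orthogonal_kernel_adjA A_symm sH.
  (* Applied to both [D] and [- D], this one-sided bound gives orthogonality. *)
  have le0 D' : symm D' -> opA A D' = 0 -> mxdot H D' <= 0.
    move=> sD' AD'; have := HX (X + D') (symmD sX sD').
    by rewrite [X + D']addrC addrK /= opAD AD' add0r AX; exact.
  apply/eqP; rewrite eq_le le0 //= -oppr_le0 -mxdotNr le0 //.
    exact: symmN.
  by rewrite -[X in opA A X]scaleN1r opAZ AD scaler0.
exists y; split => // Y pY.
have -> : adjA A y + C = - G.
  by apply/eqP; rewrite -addr_eq0 -Hy -addrA [H + _]addrC CGH.
by rewrite mxdotNl oppr_ge0 GX //; case: pY.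
Qed.

Lemma saddle_optimality X y : symm C -> saddle X y -> optimality C A b X.
Proof.
move=> C_symm [pX AX XY]; have sX : symm X by case: pX.
have sy := symm_adjA A_symm y.
exists (- (adjA A y + C)).
  apply/subdiff_indicator; split => //; first exact/symmN/symmD.
  by move=> Y _ pY; rewrite mxdotNl oppr_le0 XY.
exists (adjA A y); last by rewrite opprD addrA addrAC addrNK subrr.
rewrite (_ : (fun Y => _) =
  indicator_fun [set Y | opA A Y = b]); last first.
  by apply/funext => Y; rewrite /indicator_fun.
apply/subdiff_indicator; split => // Y _ AY.
by rewrite mxdot_adjA opAB AY AX subrr mxdotC mxdot0l.
Qed.

End Saddle.

(** * The energy *)

Section Energy.
Context {R : realType} {n m : nat}.
Variables (A : 'I_m -> 'M[R]_n) (rho L amin amax : R).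
Hypotheses (rho_gt0 : 0 < rho) (L_ge0 : 0 <= L) (rhoL : rho * L < 1).
Hypotheses (amin_gt0 : 0 < amin).
Hypothesis A_bound :
  forall U, symm U -> mxdot (opA A U) (opA A U) <= L * mxdot U U.
Implicit Types (x : 'M[R]_n) (v : 'cV[R]_m) (a : R).

(** When [a * beta = rho], this is [a] times the primal-dual hybrid gradient metric
    [|x|^2 / a + |v|^2 / beta - 2 <v, A x>]. *)
Definition energy a x v : R :=
  mxdot x x + a ^+ 2 / rho * mxdot v v - 2 * a * mxdot v (opA A x).

Definition sqn x v : R := mxdot x x + mxdot v v.

Lemma sqn_ge0 x v : 0 <= sqn x v.
Proof. by rewrite addr_ge0 // mxdot_ge0. Qed.

(* Young's inequality with a weight strictly between [L] and [1 / rho]. *)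
Lemma energy_coercive : exists2 c : R, 0 < c &
  forall a x v, amin <= a -> symm x -> c * sqn x v <= energy a x v.
Proof.
have m0 := amin_gt0; have L0 := L_ge0.
pose t := (L + rho^-1) / 2.
have Lr : L < rho^-1 by rewrite -(ltr_pM2l rho_gt0) mulfV // gt_eqF.
have ri : 0 < rho^-1 by rewrite invr_gt0.
have t0 : 0 < t by rewrite /t divr_gt0 //; lra.
have Lt : L < t by rewrite /t; lra.
have tr : t < rho^-1 by rewrite /t; lra.
have c1 : 0 < 1 - t^-1 * L by rewrite subr_gt0 mulrC ltr_pdivrMr // mul1r.
have c2 : 0 < amin ^+ 2 * (rho^-1 - t) by rewrite mulr_gt0 ?exprn_gt0 ?subr_gt0.
(* These are the coefficients that Young's inequality leaves to [|x|^2] and [|v|^2]; using [amin]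
   makes the second uniform in [a]. *)
exists (Num.min (1 - t^-1 * L) (amin ^+ 2 * (rho^-1 - t))).
  by rewrite lt_min c1.
move=> a x v aa sx.
set c := Num.min _ _.
have cx : c * mxdot x x <= (1 - t^-1 * L) * mxdot x x.
  by rewrite ler_wpM2r ?mxdot_ge0 // ge_min lexx.
have cv : c * mxdot v v <= a ^+ 2 * (rho^-1 - t) * mxdot v v.
  rewrite ler_wpM2r ?mxdot_ge0 //.
  apply: (@le_trans _ _ (amin ^+ 2 * (rho^-1 - t))).
    by rewrite ge_min lexx orbT.
  apply: ler_wpM2r; first by rewrite subr_ge0 ltW.
  by rewrite ler_pXn2r ?nnegrE //; lra.
have := mxdot_young (a *: v) (opA A x) t0; rewrite !mxdotE => Y.
have := A_bound sx; have ti : 0 < t^-1 by rewrite invr_gt0.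
rewrite -(ler_pM2l ti) => Z.
rewrite /energy /sqn mulrDr.
have -> : a ^+ 2 / rho * mxdot v v = a ^+ 2 * (rho^-1 - t) * mxdot v v +
    t * (a * (a * mxdot v v)) by ring.
lra.
Qed.

Lemma energy_le_sqn a x v : 0 <= a <= amax -> symm x ->
  energy a x v <= (1 + L + amax ^+ 2 * (rho^-1 + 1)) * sqn x v.
Proof.
have L0 := L_ge0; move=> /andP[a0 aM] sx.
have := mxdot_youngN (a *: v) (opA A x) ltr01; rewrite !mxdotE invr1 => Y.
have Z := A_bound sx; have X0 := mxdot_ge0 x; have V0 := mxdot_ge0 v.
have a2 : a ^+ 2 <= amax ^+ 2 by rewrite ler_pXn2r ?nnegrE //; lra.
have ri : 0 < rho^-1 by rewrite invr_gt0.
have av : a ^+ 2 * (rho^-1 + 1) * mxdot v v <=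
    amax ^+ 2 * (rho^-1 + 1) * mxdot v v.
  by rewrite ler_wpM2r // ler_wpM2r //; lra.
have ax : 0 <= amax ^+ 2 * (rho^-1 + 1) * mxdot x x.
  by rewrite mulr_ge0 // mulr_ge0 ?sqr_ge0 //; lra.
have lv : 0 <= L * mxdot v v by rewrite mulr_ge0.
rewrite /energy /sqn; nra.
Qed.

(** The identity [|x1|^2 + |x1 - x0|^2 - |x0|^2 = 2 <x1 - x0, x1>], and its analogue for [v], reduce
    the claim to the two update relations. The bilinear terms then cancel except for the one with
    factor [theta - 1]. *)
Lemma energy_step a beta theta x0 x1 v0 v1 :
  a * beta = rho -> mxdot (x1 - x0) x1 <= - (a * mxdot v0 (opA A x1)) ->
  v1 = v0 + beta *: opA A (x1 + theta *: (x1 - x0)) ->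
  energy a x1 v1 + energy a (x1 - x0) (v1 - v0) <=
  energy a x0 v0 + 2 * (a * (theta - 1)) * mxdot v1 (opA A (x1 - x0)).
Proof.
move=> ab Hx Hv.
have Hw : a ^+ 2 / rho * mxdot (v1 - v0) v1 =
    a * mxdot (opA A (x1 + theta *: (x1 - x0))) v1.
  rewrite {1}Hv [v0 + _]addrC addrK mxdotZl -ab.
  have [a0 b0] : a != 0 /\ beta != 0.
    by apply/andP; rewrite -negb_or -mulf_eq0 ab gt_eqF.
  by field; rewrite a0 b0.
move: Hw Hx; rewrite /energy opAD opAZ !opAB !mxdotE.
rewrite !(mxdotC (opA A _)) (mxdotC x1 x0) (mxdotC v1 v0).
set s := a ^+ 2 / rho.
move=> Hw Hx; nra.
Qed.

(** The difference of the two energies has the factor [a' - a]; Young's inequality bounds the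
    cofactor. *)
Lemma energy_param a a' x v : 0 <= a <= amax -> 0 <= a' <= amax -> symm x ->
  energy a' x v <=
    energy a x v + `|a' - a| * ((2 * amax / rho + 1 + L) * sqn x v).
Proof.
have L0 := L_ge0; move=> /andP[a0 aM] /andP[a'0 a'M] sx.
have Y := mxdot_youngN v (opA A x) ltr01.
have Y' := mxdot_young v (opA A x) ltr01.
have Z := A_bound sx; have X0 := mxdot_ge0 x; have V0 := mxdot_ge0 v.
have ri : 0 < rho^-1 by rewrite invr_gt0.
rewrite invr1 in Y Y'.
have -> : energy a' x v = energy a x v +
    (a' - a) * ((a' + a) / rho * mxdot v v - 2 * mxdot v (opA A x)).
  by rewrite /energy; field; rewrite gt_eqF.
rewrite lerD2l; apply: le_trans (ler_norm _) _; rewrite normrM ler_wpM2l //.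
have av : (a' + a) / rho * mxdot v v <= 2 * amax / rho * mxdot v v.
  by rewrite ler_wpM2r // ler_wpM2r //; lra.
have av0 : 0 <= (a' + a) / rho * mxdot v v.
  by rewrite mulr_ge0 // mulr_ge0 //; lra.
have ax : 0 <= 2 * amax / rho * mxdot x x.
  by rewrite mulr_ge0 // mulr_ge0 //; lra.
have lv : 0 <= L * mxdot v v by rewrite mulr_ge0.
by rewrite ler_norml /sqn; apply/andP; split; nra.
Qed.

(** The errors caused by varying step sizes involve the new iterate; this crude growth bound refers
    them back to the old one. *)
Lemma iterate_sqn_le a beta theta x0 x1 v0 v1 : 0 <= a <= amax ->
  symm x0 -> symm x1 ->
  mxdot (x1 - x0) x1 <= - (a * mxdot v0 (opA A x1)) ->
  v1 = v0 + beta *: opA A (x1 + theta *: (x1 - x0)) ->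
  forall B T, beta ^+ 2 <= B -> theta ^+ 2 <= T ->
  sqn x1 v1 <= (2 + 2 * B * L * (4 * T) +
    (1 + 2 * B * L * (2 + 4 * T)) * (2 + 2 * (L + 1) * amax ^+ 2)) * sqn x0 v0.
Proof.
have L0 := L_ge0; move=> /andP[a0 aM] sx0 sx1 Hx Hv B T bB tT.
have X0 := mxdot_ge0 x0; have X1 := mxdot_ge0 x1; have V0 := mxdot_ge0 v0.
have B0 : 0 <= B := le_trans (sqr_ge0 _) bB.
have T0 : 0 <= T := le_trans (sqr_ge0 _) tT.
have hx1 : mxdot x1 x1 <= (2 + 2 * (L + 1) * amax ^+ 2) * sqn x0 v0.
  (* The Young weights 2 and [2 * (L + 1)] each leave at most half of [|x1|^2] on the right, which
     the left side absorbs; [L + 1] keeps the weight positive when [L = 0]. *)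
  have t0 : 0 < 2 * (L + 1) by lra.
  have := mxdot_youngN (a *: v0) (opA A x1) t0.
  have := mxdot_young x0 x1 (ltr0n R 2); rewrite !mxdotE => Y1 Y2.
  have Z : (2 * (L + 1))^-1 * mxdot (opA A x1) (opA A x1) <= 2^-1 * mxdot x1 x1.
    apply: (@le_trans _ _ ((2 * (L + 1))^-1 * (L * mxdot x1 x1))).
      by rewrite ler_wpM2l ?invr_ge0 ?A_bound // ltW.
    rewrite mulrA ler_wpM2r // ler_pdivrMl //; lra.
  have a2 : a ^+ 2 <= amax ^+ 2 by rewrite ler_pXn2r ?nnegrE //; lra.
  have av : 2 * (L + 1) * (a * (a * mxdot v0 v0)) <=
      2 * (L + 1) * amax ^+ 2 * mxdot v0 v0.
    by rewrite (mulrA a) -expr2 mulrA ler_wpM2r // ler_wpM2l // ltW.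
  have ax : 0 <= 2 * (L + 1) * amax ^+ 2 * mxdot x0 x0.
    by rewrite mulr_ge0 // mulr_ge0 ?sqr_ge0 // ltW.
  move: Hx; rewrite /sqn !mxdotE; lra.
have hv1 : mxdot v1 v1 <= 2 * mxdot v0 v0 + 2 * B * L *
    ((2 + 4 * T) * mxdot x1 x1 + 4 * T * mxdot x0 x0).
  rewrite Hv; apply: le_trans (mxdot_sqrD _ _) _.
  rewrite lerD2l -!mulrA ler_wpM2l // mxdotZl mxdotZr mulrA -expr2.
  apply: ler_pM; rewrite ?sqr_ge0 ?mxdot_ge0 //.
  have sz : symm (x1 + theta *: (x1 - x0)).
    by apply: symmD => //; apply: symmZ; apply: symmB.
  apply: le_trans (A_bound sz) _; rewrite ler_wpM2l //.
  apply: le_trans (mxdot_sqrD _ _) _; rewrite mxdotZl mxdotZr.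
  have := mxdot_sqrB x1 x0; have D0 := mxdot_ge0 (x1 - x0).
  have : theta ^+ 2 * mxdot (x1 - x0) (x1 - x0) <=
         T * mxdot (x1 - x0) (x1 - x0) by rewrite ler_wpM2r.
  move=> H1 /(ler_wpM2l T0) H2.
  lra.
set K := 2 + 2 * (L + 1) * amax ^+ 2 in hx1 *.
have BL : 0 <= 2 * B * L by rewrite mulr_ge0 // mulr_ge0.
have BLT : 0 <= 2 * B * L * (4 * T) by rewrite mulr_ge0 // mulr_ge0.
have BL2 : 0 <= 2 * B * L * (2 + 4 * T) by rewrite mulr_ge0 //; lra.
have p1 := ler_wpM2l BL2 hx1.
have p2 := mulr_ge0 BLT V0.
move: p1 hx1; rewrite /sqn; lra.
Qed.

(* One step of the algorithm, centred at a saddle point, with the step size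
   going through the values [a_], [a], [a']. *)
Lemma energy_descent : exists2 K : R, 0 <= K &
  forall a_ a a' beta x0 x1 v0 v1,
  amin <= a_ <= amax -> amin <= a <= amax -> amin <= a' <= amax ->
  a * beta = rho -> symm x0 -> symm x1 ->
  mxdot (x1 - x0) x1 <= - (a * mxdot v0 (opA A x1)) ->
  v1 = v0 + beta *: opA A (x1 + (a / a_) *: (x1 - x0)) ->
  energy a' x1 v1 + energy a (x1 - x0) (v1 - v0) <=
    (1 + K * (`|a' - a| + `|a - a_|)) * energy a x0 v0.
Proof.
have m0 := amin_gt0; have L0 := L_ge0.
have r0 := rho_gt0; have [c c0 coer] := energy_coercive.
pose B := (rho / amin) ^+ 2; pose T := (amax / amin) ^+ 2.
(* [K1] bounds the growth of an iterate, [K2] the cost of replacing [a] by [a'], and [K3] the cost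
   of [theta] differing from 1. *)
pose K1 := 2 + 2 * B * L * (4 * T) +
    (1 + 2 * B * L * (2 + 4 * T)) * (2 + 2 * (L + 1) * amax ^+ 2).
pose K2 := 2 * amax / rho + 1 + L.
pose K3 := amax / amin * (1 + 2 * L).
have B0 : 0 <= B by apply: sqr_ge0.
have T0 : 0 <= T by apply: sqr_ge0.
have K10 : 0 <= K1.
  have ? : 0 <= 2 * B * L by rewrite mulr_ge0 // mulr_ge0.
  rewrite /K1 addr_ge0 //; first by rewrite addr_ge0 // mulr_ge0 // mulr_ge0.
  rewrite mulr_ge0 //.
    by rewrite addr_ge0 // mulr_ge0 //; lra.
  by rewrite addr_ge0 // mulr_ge0 ?sqr_ge0 //; lra.
(* If [amax < amin], no step size satisfies the bounds and any constant will do. *)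
case: (leP amin amax) => [mM|Mm]; last first.
  exists 0 => // a_ a a' beta x0 x1 v0 v1 /andP[h1 h2]; 
    by have := le_trans h1 h2; rewrite leNgt Mm.
have M0 : 0 < amax by lra.
have K20 : 0 <= K2 by rewrite /K2 !addr_ge0 // divr_ge0 //; lra.
have K30 : 0 <= K3.
  by rewrite /K3 mulr_ge0 //; [rewrite divr_ge0 //; lra|lra].
exists ((K2 * K1 + K3 * (1 + K1)) / c).
  by rewrite divr_ge0 ?(ltW c0) // addr_ge0 // mulr_ge0 //; lra.
move=> a_ a a' beta x0 x1 v0 v1 /andP[a_m a_M] /andP[am aM] /andP[a'm a'M].
move=> ab s0 s1 Hx Hv.
have aI : 0 <= a <= amax by apply/andP; split; lra.
have a'I : 0 <= a' <= amax by apply/andP; split; lra.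
have a_0 : 0 < a_ by lra.
have N1 : sqn x1 v1 <= K1 * sqn x0 v0.
  apply: (iterate_sqn_le aI s0 s1 Hx Hv).
    have -> : beta = rho / a by rewrite -ab mulrC mulKf // gt_eqF //; lra.
    rewrite /B ler_pXn2r ?nnegrE ?divr_ge0 ?(ltW rho_gt0) //; try lra.
    by rewrite ler_wpM2l ?(ltW rho_gt0) // lef_pV2 ?posrE //; lra.
  rewrite /T ler_pXn2r ?nnegrE ?divr_ge0 //; try lra.
  apply: ler_pM; rewrite ?invr_ge0 //; try lra.
  by rewrite lef_pV2 ?posrE //; lra.
have S := energy_step ab Hx Hv.
have P := energy_param v1 aI a'I s1.
have N0 := sqn_ge0 x0 v0; have N1' := sqn_ge0 x1 v1.
have sd := symmB s1 s0.
have cross : 2 * (a * (a / a_ - 1)) * mxdot v1 (opA A (x1 - x0)) <=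
    `|a - a_| * (K3 * (sqn x0 v0 + sqn x1 v1)).
  (* The choice [theta = a / a_] turns [theta - 1] into the step variation [a - a_]. *)
  have -> : 2 * (a * (a / a_ - 1)) * mxdot v1 (opA A (x1 - x0)) =
      (a - a_) * (a / a_ * (2 * mxdot v1 (opA A (x1 - x0)))).
    by field; rewrite gt_eqF.
  apply: le_trans (ler_norm _) _; rewrite normrM ler_wpM2l //.
  rewrite normrM /K3 -mulrA; apply: ler_pM => //.
    rewrite ger0_norm; last by rewrite divr_ge0 //; lra.
    apply: ler_pM; rewrite ?invr_ge0 //; try lra.
    by rewrite lef_pV2 ?posrE //; lra.
  have Y := mxdot_youngN v1 (opA A (x1 - x0)) ltr01.
  have Y' := mxdot_young v1 (opA A (x1 - x0)) ltr01.
  rewrite invr1 in Y Y'.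
  have Z := A_bound sd; have := mxdot_sqrB x1 x0 => /(ler_wpM2l L_ge0) Z'.
  have V0 := mxdot_ge0 v0; have V1 := mxdot_ge0 v1.
  have X0 := mxdot_ge0 x0; have X1 := mxdot_ge0 x1.
  have LV0 := mulr_ge0 L_ge0 V0; have LV1 := mulr_ge0 L_ge0 V1.
  by rewrite ler_norml /sqn; apply/andP; split; lra.
have E0 := coer a x0 v0 am s0.
set E := energy a x0 v0 in E0 S *.
have N0E : sqn x0 v0 <= E / c by rewrite ler_pdivlMr // mulrC.
set d1 := `|a' - a| in P *; set d2 := `|a - a_| in cross *.
have d10 : 0 <= d1 by apply: normr_ge0.
have d20 : 0 <= d2 by apply: normr_ge0.
have N1E : sqn x1 v1 <= K1 * (E / c).
  by apply: le_trans N1 _; rewrite ler_wpM2l.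
have E0' : 0 <= E / c by apply: le_trans N0E.
have t1 : d1 * (K2 * sqn x1 v1) <= d1 * (K2 * (K1 * (E / c))).
  by do 2!rewrite ler_wpM2l //.
have t2 : d2 * (K3 * (sqn x0 v0 + sqn x1 v1)) <=
    d2 * (K3 * (E / c + K1 * (E / c))).
  by do 2!rewrite ler_wpM2l //; apply: lerD.
(* [t3] and [t4] pad the errors so that one constant multiplies both [d1] and [d2]. *)
have t3 : 0 <= d1 * (K3 * (1 + K1) * (E / c)).
  by rewrite mulr_ge0 // mulr_ge0 // mulr_ge0 //; lra.
have t4 : 0 <= d2 * (K2 * K1 * (E / c)).
  by rewrite mulr_ge0 // mulr_ge0 // mulr_ge0.
have -> : (1 + (K2 * K1 + K3 * (1 + K1)) / c * (d1 + d2)) * E =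
   E + (d1 * (K2 * (K1 * (E / c))) + d2 * (K3 * (E / c + K1 * (E / c)))) +
   (d1 * (K3 * (1 + K1) * (E / c)) + d2 * (K2 * K1 * (E / c))).
  by ring.
move: S P cross; rewrite -/K2; lra.
Qed.

End Energy.

(** * Convergence of the iterates *)

Lemma psd_lim (R : realType) (n : nat) (U : nat -> 'M[R]_n) (U' : 'M[R]_n) :
  (forall k, psd (U k)) -> (forall i j, U k i j @[k --> \oo] --> U' i j) ->
  psd U'.
Proof.
move=> pU UU'; split; first by apply: symm_lim UU' => k; case: (pU k).
move=> v.
(* A quadratic form is linear in its matrix, so nonnegativity passes to the limit. *)
have E (V : 'M[R]_n) : (v^T *m V *m v) 0 0 = mxdot (v *m v^T) V.
  rewrite mxE /mxdot exchange_big; apply: eq_bigr => j _ /=.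
  rewrite mxE mulr_suml; apply: eq_bigr => i _.
  by rewrite !mxE big_ord1 !mxE; ring.
rewrite E.
have vU : mxdot (v *m v^T) (U k) @[k --> \oo] --> mxdot (v *m v^T) U'.
  by apply: cvg_mxdot UU' => i j; apply: cvg_cst.
apply: ler_cvg_to (cvg_cst _) vU _; apply: nearW => k.
by case: (pU k) => _ /(_ v); rewrite E.
Qed.

Lemma cvg_opA (R : realType) (n m : nat) (A : 'I_m -> 'M[R]_n)
    (U : nat -> 'M[R]_n) (U' : 'M[R]_n) :
  (forall i j, U k i j @[k --> \oo] --> U' i j) ->
  forall i j, opA A (U k) i j @[k --> \oo] --> opA A U' i j.
Proof.
move=> UU' i j; under eq_cvg do rewrite mxE.
by rewrite mxE; apply: cvg_mxdot UU' => i' j'; apply: cvg_cst.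
Qed.

Lemma cvg_entryB (R : realType) (p q : nat) (U V : nat -> 'M[R]_(p, q))
    (U' V' : 'M[R]_(p, q)) :
  (forall i j, U k i j @[k --> \oo] --> U' i j) ->
  (forall i j, V k i j @[k --> \oo] --> V' i j) ->
  forall i j, (U k - V k) i j @[k --> \oo] --> (U' - V') i j.
Proof.
move=> UU' VV' i j; under eq_cvg do rewrite !mxE.
by rewrite !mxE; apply: cvgB.
Qed.

Lemma cvg_entry_subK (R : realType) (p q : nat) (U V : nat -> 'M[R]_(p, q))
    (U' V' : 'M[R]_(p, q)) :
  (forall i j, (U k - V k) i j @[k --> \oo] --> U' i j) ->
  (forall i j, V k i j @[k --> \oo] --> V' i j) ->
  forall i j, U k i j @[k --> \oo] --> (U' + V') i j.
Proof.
move=> UU' VV' i j.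
have -> : (fun k => U k i j) = (fun k => (U k - V k) i j + V k i j).
  by apply/funext => k; rewrite !mxE subrK.
by rewrite mxE; apply: cvgD.
Qed.

Lemma cvg_entry_cst (R : realType) (p q : nat) (U : 'M[R]_(p, q)) i j :
  U i j @[k --> \oo] --> U i j.
Proof. exact: cvg_cst. Qed.

Arguments cvg_entry_cst {R p q} U i j.
Arguments cvg_entryB {R p q U V U' V'} _ _ i j.
Arguments cvg_entry_subK {R p q U V U' V'} _ _ i j.
Arguments cvg_opA {R n m} A {U U'} _ i j.

Section Iterates.
Context {R : realType} {n m : nat}.
Variables (C : 'M[R]_n) (A : 'I_m -> 'M[R]_n) (b : 'cV[R]_m).

(** Add the projection inequality tested at [Xh] to [a] times the saddle inequality tested at [X1];
    the terms in [C] cancel. *)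
Lemma proj_saddle_step X0 X1 y0 a Xh yh : 0 <= a ->
  is_proj (@psd R n) (X0 - a *: (adjA A y0 + C)) X1 -> saddle C A b Xh yh ->
  mxdot (X1 - Xh - (X0 - Xh)) (X1 - Xh) <=
    - (a * mxdot (y0 - yh) (opA A (X1 - Xh))).
Proof.
move=> a0 pr [ph _ /(_ X1) hh].
have := is_proj_psd_le pr ph; have {}hh := ler_wpM2l a0 (hh pr.1).
rewrite -mxdot_adjA adjAB; move: hh; rewrite mulr0 !mxdotE; lra.
Qed.

Lemma dual_saddle_step X0 X1 y0 y1 beta theta Xh yh :
  y1 = y0 + beta *: opA A (X1 + theta *: (X1 - X0)) - beta *: b ->
  saddle C A b Xh yh ->
  y1 - yh = y0 - yh +
    beta *: opA A (X1 - Xh + theta *: (X1 - Xh - (X0 - Xh))).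
Proof.
move=> -> [_ <- _].
have -> : X1 - Xh + theta *: (X1 - Xh - (X0 - Xh)) =
    X1 + theta *: (X1 - X0) - Xh by rewrite opprB addrA subrK addrAC.
by rewrite opAB; apply/matrixP => i j; rewrite !mxE; ring.
Qed.

(** Solving the dual update for the residual, with [1 / beta = a / rho], expresses it through the
    increments alone. Vanishing increments thus make cluster points feasible. *)
Lemma residual_le X0 X1 y0 y1 a beta theta rho L T amax : 0 < rho -> 0 <= L ->
  (forall U, symm U -> mxdot (opA A U) (opA A U) <= L * mxdot U U) ->
  0 <= a <= amax -> theta ^+ 2 <= T -> a * beta = rho -> symm X0 -> symm X1 ->
  y1 = y0 + beta *: opA A (X1 + theta *: (X1 - X0)) - beta *: b ->
  mxdot (opA A X1 - b) (opA A X1 - b) <=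
    (2 * (amax / rho) ^+ 2 + 2 * T * L) * sqn (X1 - X0) (y1 - y0).
Proof.
move=> r0 L0 AL /andP[a0 aM] tT ab s0 s1 Hy.
have -> : opA A X1 - b =
    (a / rho) *: (y1 - y0) - theta *: opA A (X1 - X0).
  have [a_0 b_0] : a != 0 /\ beta != 0.
    by apply/andP; rewrite -negb_or -mulf_eq0 ab gt_eqF.
  rewrite Hy opAD opAZ -ab; apply/matrixP => i j; rewrite !mxE.
  by field; rewrite a_0 b_0.
apply: le_trans (mxdot_sqrB _ _) _; rewrite !mxdotZl !mxdotZr.
have sd := symmB s1 s0; have H1 := AL _ sd.
have D0 := mxdot_ge0 (X1 - X0); have Y0 := mxdot_ge0 (y1 - y0).
have T0 : 0 <= T := le_trans (sqr_ge0 _) tT.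
have h1 : theta ^+ 2 * mxdot (opA A (X1 - X0)) (opA A (X1 - X0)) <=
    T * (L * mxdot (X1 - X0) (X1 - X0)).
  by apply: ler_pM => //; [exact: sqr_ge0|exact: mxdot_ge0].
have h2 : (a / rho) ^+ 2 * mxdot (y1 - y0) (y1 - y0) <=
    (amax / rho) ^+ 2 * mxdot (y1 - y0) (y1 - y0).
  apply: ler_wpM2r => //; rewrite ler_pXn2r ?nnegrE ?divr_ge0 ?(ltW r0) //.
    by rewrite ler_wpM2r // invr_ge0 ltW.
  exact: le_trans aM.
have h3 : 0 <= (amax / rho) ^+ 2 * mxdot (X1 - X0) (X1 - X0).
  by rewrite mulr_ge0 ?sqr_ge0.
have h4 : 0 <= T * (L * mxdot (y1 - y0) (y1 - y0)) by rewrite !mulr_ge0.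
rewrite /sqn; lra.
Qed.

Variables (X : nat -> 'M[R]_n) (y : nat -> 'cV[R]_m).
Variables (alpha theta beta : nat -> R) (amin amax rho L S : R).
Hypotheses (rho_gt0 : 0 < rho) (L_ge0 : 0 <= L) (rhoL : rho * L < 1).
Hypotheses (amin_gt0 : 0 < amin).
Hypothesis A_bound :
  forall U, symm U -> mxdot (opA A U) (opA A U) <= L * mxdot U U.
Hypothesis X_symm : forall k, symm (X k).
Hypothesis X_step : forall k,
  is_proj (@psd R n) (X k - alpha k *: (adjA A (y k) + C)) (X k.+1).
Hypothesis y_step : forall k, y k.+1 =
  y k + beta k *: opA A (X k.+1 + theta k *: (X k.+1 - X k)) - beta k *: b.
Hypothesis alpha_bounds : forall k, amin <= alpha k <= amax.
Hypothesis theta_def : forall k, theta k.+1 = alpha k.+1 / alpha k.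
Hypothesis alpha_beta : forall k, alpha k * beta k = rho.
Hypothesis alpha_variation :
  forall k, \sum_(0 <= i < k) `|alpha i.+1 - alpha i| <= S.

(* The indices are shifted by one because [theta 0] is arbitrary. *)
Lemma iterates_fejer : exists2 K : R, 0 <= K & forall Xh yh,
  saddle C A b Xh yh ->
  (forall k l, (k <= l)%N ->
     sqn (X l.+1 - Xh) (y l.+1 - yh) <= K * sqn (X k.+1 - Xh) (y k.+1 - yh)) /\
  sqn (X k.+2 - X k.+1) (y k.+2 - y k.+1) @[k --> \oo] --> 0.
Proof.
have r0 := rho_gt0; have L0 := L_ge0; have m0 := amin_gt0.
have [c c0 coer] := energy_coercive r0 L0 rhoL m0 A_bound.
have [Kd Kd0 desc] := energy_descent amax r0 L0 rhoL m0 A_bound.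
pose Ku := 1 + L + amax ^+ 2 * (rho^-1 + 1).
have a_I k : 0 <= alpha k <= amax.
  by have /andP[a1 ->] := alpha_bounds k; rewrite andbT; lra.
have ri : 0 < rho^-1 by rewrite invr_gt0.
have Ku0 : 0 <= Ku.
  by rewrite /Ku !addr_ge0 // mulr_ge0 ?sqr_ge0 //; lra.
pose e k := Kd * (`|alpha k.+2 - alpha k.+1| + `|alpha k.+1 - alpha k|).
have eS k : \sum_(0 <= i < k) e i <= Kd * (S + S).
  rewrite -mulr_sumr ler_wpM2l // big_split /= lerD ?alpha_variation //.
  (* The sum of the later differences is the variation up to [k.+1] without its first term. *)
  apply: le_trans (alpha_variation k.+1).
  by rewrite big_nat_recl // lerDr.
exists (expR (Kd * (S + S)) * Ku / c).
  by rewrite divr_ge0 ?(ltW c0) // mulr_ge0 // expR_ge0.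
move=> Xh yh sad; have sh : symm Xh by case: sad => -[].
pose E k := energy A rho (alpha k.+1) (X k.+1 - Xh) (y k.+1 - yh).
pose D k := energy A rho (alpha k.+1) (X k.+2 - X k.+1) (y k.+2 - y k.+1).
have coerE k : c * sqn (X k.+1 - Xh) (y k.+1 - yh) <= E k.
  by apply: coer; [have /andP[] := alpha_bounds k.+1|exact: symmB].
have coerD k : c * sqn (X k.+2 - X k.+1) (y k.+2 - y k.+1) <= D k.
  by apply: coer; [have /andP[] := alpha_bounds k.+1|exact: symmB].
have EDstep k : E k.+1 + D k <= (1 + e k) * E k.
  have sub0 p q (U V W : 'M[R]_(p, q)) : U - V = U - W - (V - W).
    by rewrite opprB addrA subrK.
  rewrite /E /D (sub0 _ _ (X k.+2) (X k.+1) Xh) (sub0 _ _ (y k.+2) (y k.+1) yh).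
  apply: (desc _ _ _ (beta k.+1)) => //; try exact: symmB.
    by apply: proj_saddle_step (X_step _) sad; have /andP[] := a_I k.+1.
  by rewrite -theta_def; apply: dual_saddle_step (y_step _) sad.
have [|||Emono D_0] := @quasi_fejer _ E D e (Kd * (S + S)) _ _ _ eS EDstep.
- by move=> k; apply: le_trans (coerE k); rewrite mulr_ge0 ?sqn_ge0 // ltW.
- by move=> k; apply: le_trans (coerD k); rewrite mulr_ge0 ?sqn_ge0 // ltW.
- by move=> k; rewrite mulr_ge0 // addr_ge0.
split=> [k l kl|].
  rewrite mulrAC ler_pdivlMr // mulrC; apply: le_trans (coerE l) _.
  apply: le_trans (Emono _ _ kl) _; rewrite -mulrA ler_wpM2l ?expR_ge0 //.
  exact: energy_le_sqn (symmB _ _).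
have cD : c^-1 * D k @[k --> \oo] --> 0.
  by rewrite -(mulr0 c^-1); apply: cvgM => //; exact: cvg_cst.
apply: squeeze_cvgr cD; last exact: cvg_cst.
by apply: nearW => k; rewrite sqn_ge0 /= ler_pdivlMl.
Qed.

(** Fejer bounds make the iterates bounded, hence a subsequence converges. As increments vanish, the
    next primal iterate has the same limit, and the residual bound and the projection inequality
    pass to the limit. *)
Lemma iterates_cluster Xh yh : saddle C A b Xh yh ->
  exists (h : nat -> nat) (Xs : 'M[R]_n) (ys : 'cV[R]_m),
  [/\ forall k, (k <= h k)%N,
      forall i j, X (h k).+1 i j @[k --> \oo] --> Xs i j,
      forall i j, y (h k).+1 i j @[k --> \oo] --> ys i j &
      saddle C A b Xs ys].
Proof.
have r0 := rho_gt0; have L0 := L_ge0; have m0 := amin_gt0.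
have [K K0 fej] := iterates_fejer.
move=> sad; have [bnd d0] := fej _ _ sad.
set N := K * sqn (X 1 - Xh) (y 1 - yh).
have bX k : mxdot (X k.+1 - Xh) (X k.+1 - Xh) <= N.
  by apply: le_trans (bnd 0 k (leq0n k)); rewrite /sqn lerDl mxdot_ge0.
have by_ k : mxdot (y k.+1 - yh) (y k.+1 - yh) <= N.
  by apply: le_trans (bnd 0 k (leq0n k)); rewrite /sqn lerDr mxdot_ge0.
have [f [LX [fk XL]]] := bounded_mx_subseq bX.
have [g [Ly [gk yL]]] := bounded_mx_subseq (fun k => by_ (f k)).
have hk k : (k <= f (g k))%N by apply: leq_trans (gk k) (fk _).
exists (f \o g), (LX + Xh), (Ly + yh).
have XL' i j := cvg_subseq gk (XL i j).
have cX := cvg_entry_subK XL' (cvg_entry_cst Xh).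
have cy := cvg_entry_subK yL (cvg_entry_cst yh).
split => //.
set Xs := LX + Xh in cX *; set ys := Ly + yh in cy *.
have d0h := cvg_subseq hk d0.
have cdX i j : (X (f (g k)).+2 - X (f (g k)).+1) i j @[k --> \oo] -->
    (0 : 'M[R]_n) i j.
  apply: cvg_mxdot0; apply: squeeze_cvgr (cvg_cst _) d0h.
  by apply: nearW => k; rewrite subr0 mxdot_ge0 /sqn lerDl mxdot_ge0.
have cX2 := cvg_entry_subK cdX cX; rewrite add0r in cX2.
split.
- by apply: psd_lim cX => k; case: (X_step (f (g k))).
- apply/eqP; rewrite -subr_eq0; apply/eqP/mxdot_eq0.
  have cr := cvg_entryB (cvg_opA A cX2) (cvg_entry_cst b).
  have crr := cvg_mxdot cr cr.
  pose T := (amax / amin) ^+ 2.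
  pose K' := 2 * (amax / rho) ^+ 2 + 2 * T * L.
  have K'd : K' * sqn (X (f (g k)).+2 - X (f (g k)).+1)
      (y (f (g k)).+2 - y (f (g k)).+1) @[k --> \oo] --> 0.
    by rewrite -(mulr0 K'); apply: cvgM d0h; exact: cvg_cst.
  apply/eqP; rewrite eq_le mxdot_ge0 andbT.
  apply: ler_cvg_to crr K'd _; apply: nearW => k.
  set i := f (g k).
  have /andP[a1 a2] := alpha_bounds i; have /andP[a3 a4] := alpha_bounds i.+1.
  apply: (residual_le r0 L0 A_bound _ _ (alpha_beta i.+1) _ _ (y_step i.+1));
    rewrite ?X_symm //.
    by apply/andP; split; lra.
  rewrite theta_def /T ler_pXn2r ?nnegrE ?divr_ge0 //; try lra.
  apply: ler_pM; rewrite ?invr_ge0 //; try lra.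
  by rewrite lef_pV2 ?posrE //; lra.
- move=> Y pY.
  have cYX := cvg_entryB (cvg_entry_cst Y) cX2.
  have cs := cvg_mxdot cdX cYX; rewrite mxdot0l in cs.
  (* The projection inequality divided by the step size gives this lower bound; [amin^-1] dominates
     every inverse step size. *)
  have cs' : - (amin^-1 * `|mxdot (X (f (g k)).+2 - X (f (g k)).+1)
      (Y - X (f (g k)).+2)|) @[k --> \oo] --> 0.
    rewrite -oppr0 -(mulr0 amin^-1) -(normr0 R); apply: cvgN.
    by apply: cvgM; [exact: cvg_cst|exact: cvg_norm].
  have cG : mxdot (y (f (g k)).+1) (opA A (Y - X (f (g k)).+2)) +
      mxdot C (Y - X (f (g k)).+2) @[k --> \oo] -->
      mxdot (adjA A ys + C) (Y - Xs).
    rewrite mxdotDl mxdot_adjA; apply: cvgD.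
      exact: cvg_mxdot cy (cvg_opA A cYX).
    exact: cvg_mxdot (cvg_entry_cst C) cYX.
  apply: ler_cvg_to cs' cG _; apply: nearW => k; set i := f (g k).
  have /andP[a1 a2] := alpha_bounds i.+1.
  have a0 : 0 < alpha i.+1 by lra.
  have := is_proj_psd_le (X_step i.+1) pY.
  rewrite -mxdot_adjA -mxdotDl.
  have -> : X i.+1 - alpha i.+1 *: (adjA A (y i.+1) + C) - X i.+2 =
      - (X i.+2 - X i.+1) - alpha i.+1 *: (adjA A (y i.+1) + C).
    by rewrite opprB addrAC.
  set G := adjA A _ + C; set W := Y - _; set d := X i.+2 - _.
  rewrite mxdotBl mxdotNl mxdotZl => Hv.
  rewrite -(ler_pM2l a0).
  apply: (@le_trans _ _ (- `|mxdot d W|)).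
    rewrite mulrN lerN2 mulrA ler_peMl //.
    by rewrite ler_pdivlMr // mul1r.
  have := ler_norm (mxdot d W); lra.
Qed.

(** The cluster point is itself a saddle point, so the Fejer bound may be centred at it: once an
    iterate is close to it, all later ones are. *)
Lemma iterates_cvg Xh yh : saddle C A b Xh yh ->
  exists (Xs : 'M[R]_n) (ys : 'cV[R]_m), [/\ saddle C A b Xs ys,
    forall i j, X k i j @[k --> \oo] --> Xs i j &
    forall i j, y k i j @[k --> \oo] --> ys i j].
Proof.
move=> /iterates_cluster [h [Xs [ys [hk cX cy sad]]]].
have [K K0 /(_ _ _ sad)[fej _]] := iterates_fejer.
have N0 : sqn (X k - Xs) (y k - ys) @[k --> \oo] --> 0.
  have dX := cvg_entryB cX (cvg_entry_cst Xs).
  have dy := cvg_entryB cy (cvg_entry_cst ys).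
  have c0 : sqn (X (h k).+1 - Xs) (y (h k).+1 - ys) @[k --> \oo] --> 0.
    have := cvgD (cvg_mxdot dX dX) (cvg_mxdot dy dy).
    rewrite !subrr !mxdot0l addr0 => c0.
    exact: c0.
  apply/cvgrPdist_lt => e e0.
  (* [K + 1] is used because [K] may be 0. *)
  have eK : 0 < e / (K + 1) by rewrite divr_gt0 //; lra.
  move/cvgrPdist_lt: c0 => /(_ _ eK)[N _ /(_ N (leqnn N))].
  rewrite /= sub0r normrN ger0_norm ?addr_ge0 ?mxdot_ge0 //.
  rewrite ltr_pdivlMr ?mulrDr ?mulr1; last by lra.
  rewrite -/(sqn _ _) => sN.
  have sN0 := sqn_ge0 (X (h N).+1 - Xs) (y (h N).+1 - ys).
  exists (h N).+1 => // -[//|l] /= hl.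
  rewrite sub0r normrN ger0_norm ?sqn_ge0 //.
  apply: (le_lt_trans (fej (h N) l hl)); lra.
exists Xs, ys; split => //; apply: cvg_mxdot0;
  apply: squeeze_cvgr (cvg_cst _) N0; apply: nearW => k;
  by rewrite mxdot_ge0 /sqn ?lerDl ?lerDr mxdot_ge0.
Qed.

End Iterates.

Theorem theorem2p1 (R : realType) (n m : nat)
  (C : 'M[R]_n) (A : 'I_m -> 'M[R]_n) (b : 'cV[R]_m)
  (C_symm : symm C) (A_symm : forall i, symm (A i))
  (* the inclusion of the conclusion is solvable *)
  (solvable : exists X : 'M[R]_n, optimality C A b X)
  (X : nat -> 'M[R]_n) (y : nat -> 'cV[R]_m)
  (alpha theta beta : nat -> R) (alpha_min alpha_max rho : R)
  (X0_symm : symm (X 0%N))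
  (X_step : forall k, is_proj (@psd R n)
     (X k - alpha k *: (adjA A (y k) + C)) (X k.+1))
  (y_step : forall k, y k.+1 =
     y k + beta k *: opA A (X k.+1 + theta k *: (X k.+1 - X k)) - beta k *: b)
  (alpha_min_gt0 : 0 < alpha_min) (alpha_min_le_max : alpha_min <= alpha_max)
  (alpha_bounds : forall k, alpha_min < alpha k < alpha_max)
  (alpha_summable :
     (\sum_(1 <= k <oo) `|alpha k.+1 - alpha k|%:E < +oo)%E)
  (theta_def : forall k, theta k.+1 = alpha k.+1 / alpha k)
  (alpha_beta : forall k, alpha k * beta k = rho)
  (rho_gt0 : 0 < rho)
  (* inverse in \bar R, with 0^-1 = +oo: no upper bound on rho if A = 0 *)
  (rho_lt : (rho%:E < (lambda_max (fun Z => adjA A (opA A Z)))%:E^-1)%E) :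
  exists (Xs : 'M[R]_n) (ys : 'cV[R]_m),
    [/\ symm Xs, weak_cvg X y Xs ys & optimality C A b Xs].
Proof.
have [Xh /(optimality_saddle A_symm)[yh sad]] := solvable.
(* The energy estimates take a nonnegative [L]; truncating at 0 preserves [rho * L < 1]. *)
pose L := Num.max 0 (lambda_max (fun Z => adjA A (opA A Z))).
have L0 : 0 <= L by rewrite le_max lexx.
have rhoL : rho * L < 1.
  by rewrite /L maxr_pMr ?ltW // mulr0 gt_max ltr01 rho_lambda_max_lt1.
have A_bound U : symm U -> mxdot (opA A U) (opA A U) <= L * mxdot U U.
  move=> sU; apply: le_trans (opA_lambda_max A_symm sU) _.
  by rewrite ler_wpM2r ?mxdot_ge0 // le_max lexx orbT.
have X_symm k : symm (X k) by case: k => // k; have [[]] := X_step k.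
have alpha_I k : alpha_min <= alpha k <= alpha_max.
  by have /andP[/ltW -> /ltW ->] := alpha_bounds k.
set sigma := (\sum_(1 <= k <oo) _)%E in alpha_summable.
have sigma_ge k : ((\sum_(1 <= i < k) `|alpha i.+1 - alpha i|)%:E <= sigma)%E.
  rewrite -sumEFin; apply: (@nneseries_lim_ge R _ xpredT) => i _ _.
  by rewrite lee_fin.
have sigma_fin : sigma \is a fin_num.
  rewrite fin_numElt alpha_summable andbT; apply: lt_le_trans (sigma_ge 0).
  exact: ltNyr.
(* The summability assumption starts at index 1, so the first difference is added separately. *)
have variation k : \sum_(0 <= i < k) `|alpha i.+1 - alpha i| <=
    `|alpha 1%N - alpha 0%N| + fine sigma.
  case: k => [|k].
    rewrite big_nil addr_ge0 // fine_ge0 //.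
    by apply: le_trans (sigma_ge 0); rewrite big_nil.
  rewrite big_ltn // lerD2l -lee_fin fineK //.
have [Xs [ys [sads cX cy]]] := iterates_cvg rho_gt0 L0 rhoL alpha_min_gt0
  A_bound X_symm X_step y_step alpha_I theta_def alpha_beta variation sad.
exists Xs, ys; split; first by case: sads => -[].
  by move=> Z w _; apply: cvgD; apply: cvg_mxdot => // i j; exact: cvg_cst.
exact: saddle_optimality C_symm sads.
Qed.
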